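(* Let $G$ be a connected unit interval graph on $n\geq 2$ vertices. Let $v_1,\dots,v_n$ be the vertices of $G$ indexed by increasing starting dates. Then the following propositions are equivalent: \begin{enumerate} \item $G$ has outcome $\mathcal{D}$; \item $G$ has a $\{K_2,K_3\}$-factor; \item $G$ has a pairing dominating set; \item $n$ is even or some vertex $v_{2i}$ (with $1\le 2i\le n$) is not a cut-vertex of $G$. \end{enumerate}
   Context: All graphs are finite and simple; $N[v]$ denotes the closed neighborhood of $v$. A unit interval graph is the intersection graph of a family of closed intervals of the real line all of length $1$ (vertices are intervals, adjacent if and only if they intersect); such a representation is fixed, and the starting date of a vertex is the left endpoint of its interval. A cut-vertex is a vertex whose removal disconnects the graph. For a family $\mathcal{F}$ of graphs, an $\mathcal{F}$-factor of $G$ is a spanning subgraph $H$ of $G$ (same vertex set) such that each connected component of $H$ is isomorphic to some graph in $\mathcal{F}$. A pairing dominating set of $G=(V,E)$ is a set of pairs of vertices $\{(u_1,v_1),\dots,(u_k,v_k)\}$ such that all the vertices appearing in the pairs are distinct and $V=\bigcup_{i=1}^k \left(N[u_i]\cap N[v_i]\right)$. The Maker-Breaker domination game on a graph $G$: two players, Dominator and Staller, alternately claim a not-yet-claimed vertex of $G$. Dominator wins if at some point the vertices she has claimed form a dominating set of $G$. Otherwise, i.e. if Staller manages to claim a vertex and all its neighbors, Staller wins. The graph $G$ has outcome $\mathcal{D}$ if Dominator has a winning strategy whoever starts (equivalently, if Dominator has a winning strategy when playing second, since no player benefits from skipping a turn). *)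

(* Defs.v *)
From HB Require Import structures.
From mathcomp Require Import all_boot all_order all_algebra.
From mathcomp Require Import reals.

Set Implicit Arguments.
Unset Strict Implicit.
Unset Printing Implicit Defensive.

Import Order.TTheory GRing.Theory Num.Theory.

Record sgraph (T : finType) := SGraph {
  edge :> rel T;
  edge_sym : symmetric edge;
  edge_irr : irreflexive edge }.

Section Graphs.
Variables (T : finType) (G : sgraph T).
Implicit Types (A D : {set T}) (x y : T).

Definition closed_nbhd x : {set T} := [set y | (y == x) || G x y].

Definition connected : Prop := forall x y, connect G x y.

Definition component x : {set T} := [set y | connect G x y].

Definition dominating D : Prop :=
  forall x, exists2 y, y \in D & x \in closed_nbhd y.

Definition pairing_dominating (P : seq (T * T)) : Prop :=
  uniq (unzip1 P ++ unzip2 P) /\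
  \bigcup_(p <- P) (closed_nbhd p.1 :&: closed_nbhd p.2) = [set: T].

Section Induced.
Variable A : {set T}.
Definition induced_edge : rel {x : T | x \in A} :=
  fun u w => G (val u) (val w).
Fact induced_sym : symmetric induced_edge.
Proof. by move=> u w; apply: edge_sym. Qed.
Fact induced_irr : irreflexive induced_edge.
Proof. by move=> u; apply: edge_irr. Qed.
Definition induced : sgraph {x : T | x \in A} :=
  SGraph induced_sym induced_irr.
End Induced.

End Graphs.

Definition cut_vertex (T : finType) (G : sgraph T) (x : T) : Prop :=
  ~ connected (induced G (~: [set x])).

Section Complete.
Variable k : nat.
Definition complete_edge : rel 'I_k := fun i j => i != j.
Fact complete_sym : symmetric complete_edge.
Proof. by move=> i j; rewrite /complete_edge eq_sym. Qed.
Fact complete_irr : irreflexive complete_edge.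
Proof. by move=> i; rewrite /complete_edge eqxx. Qed.
Definition complete : sgraph 'I_k := SGraph complete_sym complete_irr.
End Complete.

Definition isomorphic (T U : finType) (G : sgraph T) (K : sgraph U) : Prop :=
  exists2 f : T -> U, bijective f & forall x y, K (f x) (f y) = G x y.

Definition family := forall U : finType, sgraph U -> Prop.

Inductive K2_K3 : family :=
| K2_in : K2_K3 (complete 2)
| K3_in : K2_K3 (complete 3).

Definition is_factor (F : family) (T : finType) (G H : sgraph T) : Prop :=
  subrel H G /\
  forall x, exists (U : finType) (K : sgraph U),
    F U K /\ isomorphic (induced H (component H x)) K.

(* Maker-Breaker domination game. A history (or play) is the duplicate-free    *)
(* sequence of the vertices claimed so far, in order; the two players          *)
(* alternate, and [first] tells whether Dominator makes the first move. Plays  *)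
(* are continued until the board is full: since winning means dominating at    *)
(* some point, moves made after Dominator has won are irrelevant.              *)
Section Game.
Variables (T : finType) (G : sgraph T) (first : bool).
Implicit Types (h p : seq T) (sigma : seq T -> T).

(* Whether the move made after [i] moves is Dominator's. *)
Definition dominator_turn (i : nat) : bool := odd i (+) first.

Definition dominator_claimed h : {set T} :=
  [set x in h | dominator_turn (index x h)].

Definition legal_strategy sigma : Prop :=
  forall h, uniq h -> size h < #|T| -> dominator_turn (size h) ->
    sigma h \notin h.

Definition full_play p : Prop := uniq p /\ size p = #|T|.

Definition follows sigma p : Prop :=
  forall h x r, p = h ++ x :: r -> dominator_turn (size h) -> x = sigma h.

Definition dominator_wins p : Prop :=
  exists k : nat, dominating G (dominator_claimed (take k p)).

(* Legality of sigma matters: an illegal strategy is followed by no full play. *)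
Definition dominator_has_winning_strategy : Prop :=
  exists2 sigma, legal_strategy sigma &
    forall p, full_play p -> follows sigma p -> dominator_wins p.

End Game.

Definition outcome_D (T : finType) (G : sgraph T) : Prop :=
  forall first : bool, dominator_has_winning_strategy G first.

Section UnitInterval.
Variables (R : realType) (T : finType).
Local Open Scope ring_scope.

(* The interval of x is [start x, start x + 1]. *)
Definition unit_interval_rep (G : sgraph T) (start : T -> R) : Prop :=
  forall x y, x != y ->
    (G x y <-> exists t : R, t \in `[start x, start x + 1] /\
                             t \in `[start y, start y + 1]).

End UnitInterval.

(* Main.v *)
(**
   In a connected unit interval graph consecutive vertices are adjacent, and
   an edge between [v_i] and [v_j] forces all edges between vertices of index
   in the range from [i] to [j].  Hence an inner vertex is a cut-vertex iff its predecessor and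
   successor are not adjacent.
   - (1) => (4): let [n] be odd and all [v_(2i)] be cut-vertices, so that the
     closed neighborhood of [v_(2i+1)] lies in [v_(2i), v_(2i+1), v_(2i+2)].
     Staller starts and claims [v_2, v_4, ...] in this order. Dominator is forced
     to answer [v_1, v_3, ...], and Staller finally isolates [v_n].
   - (4) => (2): cut [v_1, ..., v_n] into consecutive pairs, with one triple
     centred at a non-cut-vertex [v_(2i)] if [n] is odd.
   - (2) => (3): take two vertices in each component of the factor.
   - (3) => (1): Dominator always answers in the pair Staller just played in.
*)
Require Import Defs.
From mathcomp Require Import all_boot all_order all_algebra.
From mathcomp Require Import reals zify lra.

Set Implicit Arguments.
Unset Strict Implicit.
Unset Printing Implicit Defensive.

Import Order.TTheory GRing.Theory Num.Theory.

(** * Duplicate-free sequences and full plays *)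

Lemma uniq_map_inj_in (T1 T2 : eqType) (f : T1 -> T2) (s : seq T1) :
  uniq (map f s) -> {in s &, injective f}.
Proof.
elim: s => //= a s IHs /andP[fa_s u] x y; rewrite !inE.
case/predU1P=> [->|xs] /predU1P[->|ys] // fxy; last exact: IHs.
- by rewrite fxy map_f in fa_s.
- by rewrite -fxy map_f in fa_s.
Qed.

Lemma mem_full_play (T : finType) (p : seq T) : full_play p -> forall x, x \in p.
Proof.
move=> [up sp] x; have /subset_cardP : #|p| = #|T| by rewrite (card_uniqP up) sp.
by move/(_ (subset_predT _))/(_ x) => ->.
Qed.

Lemma exists_unclaimed (T : finType) (h : seq T) :
  uniq h -> size h < #|T| -> exists x, x \notin h.
Proof.
move=> /card_uniqP <- sh; apply/existsP; rewrite -negb_forall.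
by apply: contraTN sh => /forallP full; rewrite -leqNgt; apply/subset_leq_card/subsetP.
Qed.

(** * Dominator's pairing strategy *)

Section Pairing.
Variables (T : finType) (P : seq (T * T)).
Hypothesis uniqP : uniq (unzip1 P ++ unzip2 P).

Definition paired : rel T := fun x y => ((x, y) \in P) || ((y, x) \in P).

Lemma pairedC : symmetric paired.
Proof. by move=> x y; rewrite /paired orbC. Qed.

Lemma paired_uniq x y z : paired x y -> paired x z -> y = z.
Proof.
move: uniqP; rewrite cat_uniq => /and3P[u1 /hasPn dis u2].
have disj a b c : (a, b) \in P -> (c, a) \in P -> False.
  move=> abP caP; have /negP := dis a (map_f snd caP).
  by apply; apply: (map_f fst abP).
case/orP=> [xyP|yxP] /orP[xzP|zxP].
- by case: (uniq_map_inj_in u1 xyP xzP erefl).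
- by case: (disj _ _ _ xyP zxP).
- by case: (disj _ _ _ xzP yxP).
- by case: (uniq_map_inj_in u2 yxP zxP erefl).
Qed.

Lemma paired_irr x : paired x x = false.
Proof.
apply/negP; rewrite /paired orbb => xxP.
move: uniqP; rewrite cat_uniq => /and3P[_ /hasPn/(_ x (map_f snd xxP))/negP[]].
exact: (map_f fst xxP).
Qed.

(** [x0] stands for the last move when the history is empty; opening with the partner of [x0] does
    no harm. If the last move has no free partner, any free vertex is taken. *)
Definition pairing_strategy (x0 : T) (h : seq T) : T :=
  if [pick y | paired (last x0 h) y & y \notin h] is Some y then y
  else odflt x0 [pick y | y \notin h].

Lemma pairing_strategy_legal first x0 :
  legal_strategy first (pairing_strategy x0).
Proof.
move=> h uh sh _; rewrite /pairing_strategy.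
case: pickP => [y /andP[]//|_]; case: pickP => [//|none].
by have [x xh] := exists_unclaimed uh sh; rewrite none in xh.
Qed.

Lemma pairing_strategy_answer x0 h x y :
  last x0 h = x -> paired x y -> y \notin h -> pairing_strategy x0 h = y.
Proof.
move=> lx pxy yh; rewrite /pairing_strategy lx.
case: pickP => [z /andP[pxz _]|/(_ y)]; first exact: paired_uniq pxz pxy.
by rewrite pxy yh.
Qed.

(** If [x], the earlier of the two, went to Staller, the next move is Dominator's; [y] is then still
    free and is the only partner of [x], so the strategy claims it. *)
Lemma pairing_strategy_wins_pair first x0 p x y :
    full_play p -> follows first (pairing_strategy x0) p ->
    paired x y -> index x p < index y p ->
  (x \in dominator_claimed first p) || (y \in dominator_claimed first p).
Proof.
move=> [up sp] fp pxy ltxy.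
have inp := mem_full_play (conj up sp).
rewrite !inE !inp /=; case: (boolP (dominator_turn first (index x p))) => //= nx.
have sizexy : (index x p).+1 < size p by rewrite (leq_ltn_trans ltxy) ?index_mem.
pose h := take (index x p).+1 p.
have sh : size h = (index x p).+1 by rewrite size_takel // ltnW.
have dh : dominator_turn first (size h).
  by move: nx; rewrite sh /dominator_turn /= addNb.
have lh : last x0 h = x.
  by rewrite /h (take_nth x0) ?index_mem // last_rcons nth_index.
have := fp h (nth x0 p (index x p).+1) (drop (index x p).+2 p).
rewrite -drop_nth // cat_take_drop => /(_ erefl dh).
have yh : y \notin h.
  by apply/negP=> /index_ltn; rewrite ltnS leqNgt ltxy.
rewrite (pairing_strategy_answer lh pxy yh) => <-.
by rewrite index_uniq // -sh.
Qed.

End Pairing.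

Lemma outcome_D_pairing (T : finType) (G : sgraph T) (P : seq (T * T)) (x0 : T) :
  pairing_dominating G P -> outcome_D G.
Proof.
move=> [uP covP] first; exists (pairing_strategy P x0).
  exact: pairing_strategy_legal.
move=> p fullp followp; exists (size p) => x; rewrite take_size.
have : x \in \bigcup_(q <- P) (closed_nbhd G q.1 :&: closed_nbhd G q.2).
  by rewrite covP inE.
rewrite bigcup_seq => /bigcupP[[u w] /= uwP /setIP[xu xw]].
have puw : paired P u w by rewrite /paired uwP.
have nuw : u != w by apply/eqP=> uw; rewrite uw paired_irr in puw.
have inp := mem_full_play fullp.
suff /orP[] : (u \in dominator_claimed first p) || (w \in dominator_claimed first p).
- by exists u.
- by exists w.
case: (ltngtP (index u p) (index w p)) => [lt|lt|eq_i].
- exact: (pairing_strategy_wins_pair uP fullp followp).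
- rewrite orbC; apply: (pairing_strategy_wins_pair uP fullp followp _ lt).
  by rewrite pairedC.
- by case/eqP: nuw; rewrite -(nth_index u (inp u)) eq_i nth_index.
Qed.

(** * Factors into small cliques and pairing dominating sets *)

Section Factors.
Variable T : finType.
Implicit Types (G H : sgraph T) (A : {set T}).

Lemma sgraph_connect_sym G : connect_sym G.
Proof. exact: (sym_connect_sym (edge_sym G)). Qed.

Lemma isomorphic_complete G A :
  {in A &, forall x y, x != y -> G x y} ->
  isomorphic (induced G A) (complete #|A|).
Proof.
move=> clqA.
have cardA : #|{: {x : T | x \in A}}| = #|A|.
  by rewrite card_sig; apply: eq_card => x.
exists (fun u => cast_ord cardA (enum_rank u)).
  exists (fun i => enum_val (cast_ord (esym cardA) i)) => u.
  - by rewrite cast_ordK enum_rankK.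
  - by rewrite enum_valK cast_ordKV.
move=> [x xA] [y yA] /=.
rewrite /complete_edge (inj_eq (@cast_ord_inj _ _ _)) (inj_eq enum_rank_inj).
rewrite /induced_edge -val_eqE /=.
by case: eqP => [->|/eqP nxy] /=; [rewrite edge_irr | rewrite clqA].
Qed.

(** Only these two features of $K_2$ and $K_3$ enter the passage from factors to pairings. *)
Lemma K2_K3_complete (U : finType) (K : sgraph U) : K2_K3 K ->
  (forall x y, x != y -> K x y) /\ (forall x : U, exists y, y != x).
Proof.
have two k : 1 < k -> forall x : 'I_k, exists y, y != x.
  (* The vertex other than [x] is 1 if [x] is 0, and 0 otherwise. *)
  move=> k1 x; pose y b := Ordinal (leq_ltn_trans (leq_b1 b) k1).
  by exists (y (x == 0 :> nat)); rewrite -val_eqE /=; case: (val x) => [|[]].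
by case; split=> //; apply: two.
Qed.

Lemma is_factor_clique G H : is_factor K2_K3 G H ->
  forall x y, connect H x y -> x != y -> G x y.
Proof.
move=> [subHG facH] x y cxy nxy; apply: subHG.
have [U [K [/K2_K3_complete[cK _] [f bf fK]]]] := facH x.
have xC : x \in component H x by rewrite inE.
have yC : y \in component H x by rewrite inE.
have := fK (exist _ x xC) (exist _ y yC); rewrite /= /induced_edge /= => <-.
by apply: cK; rewrite (inj_eq (bij_inj bf)) -val_eqE.
Qed.

Lemma is_factor_neighbor G H : is_factor K2_K3 G H ->
  forall x, exists2 y, connect H x y & y != x.
Proof.
move=> [subHG facH] x.
have [U [K [/K2_K3_complete[_ cK] [f [g gf fg] _]]]] := facH x.
have xC : x \in component H x by rewrite inE.
have [u nu] := cK (f (exist _ x xC)).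
have := valP (g u); rewrite inE => cxu; exists (val (g u)) => //.
by apply: contraNneq nu => e; rewrite -[u]fg; apply/eqP; congr f; apply: val_inj.
Qed.

(** The root of each component is paired with another vertex of that component; as the component is
    a clique of [G], both dominate all of it. *)
Lemma pairing_of_factor G H :
  is_factor K2_K3 G H -> exists P, pairing_dominating G P.
Proof.
move=> facH; have symH := sgraph_connect_sym H.
pose r := fingraph.root H.
pose f x := odflt x [pick y | connect H x y & y != x].
have fP x : connect H x (f x) /\ f x != x.
  rewrite /f; case: pickP => [y /andP[]//|none].
  by have [y cxy nyx] := is_factor_neighbor facH x; have := none y; rewrite cxy nyx.
have rfP x : r (f x) = r x by apply/esym/(fingraph.rootP symH); have [] := fP x.
have rr x : roots H x -> r x = x by move/eqP.
exists [seq (x, f x) | x <- enum (roots H)]; split.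
  (* First coordinates are roots, second ones are not, and the root of [f x] gives back [x], so [f]
     is injective on roots. *)
  rewrite /unzip1 /unzip2 -!map_comp map_id cat_uniq enum_uniq map_inj_in_uniq.
    rewrite enum_uniq andbT; apply/hasPn=> _ /mapP[x xr ->] /=.
    move: xr; rewrite !mem_enum => /rr xr; apply/negP=> /rr.
    by rewrite rfP xr => /esym/eqP; apply/negP; have [] := fP x.
  move=> x y; rewrite !mem_enum => /rr xr /rr yr /= e.
  by rewrite -xr -yr -(rfP x) e rfP.
apply/setP=> x; rewrite [RHS]inE big_map bigcup_seq; apply/bigcupP.
exists (r x); first by rewrite mem_enum; apply: roots_root.
have mem y : connect H y x -> x \in closed_nbhd G y.
  by rewrite inE => cyx; case: eqP => //= /eqP nxy; rewrite (is_factor_clique facH) // eq_sym.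
have crx : connect H (r x) x by rewrite symH connect_root.
rewrite inE !mem //=; apply: connect_trans crx.
by rewrite symH; have [] := fP (r x).
Qed.

(** Joining distinct vertices of equal label makes the label classes the components of [H]. *)
Lemma factor_of_labelling G (l : T -> nat) :
    (forall x y, l x = l y -> x != y -> G x y) ->
    (forall x, #|[set y | l x == l y]| \in [:: 2; 3]) ->
  exists H, is_factor K2_K3 G H.
Proof.
move=> clq card_l.
pose e : rel T := fun x y => (x != y) && (l x == l y).
have esym : symmetric e by move=> x y; rewrite /e !(eq_sym x, eq_sym (l x)).
have eirr : irreflexive e by move=> x; rewrite /e eqxx.
pose H := SGraph esym eirr; exists H.
split=> [x y /andP[nxy /eqP lxy]|x]; first exact: clq.
have compE : component H x = [set y | l x == l y].
  apply/setP=> y; rewrite !inE; apply/idP/idP=> [cxy|lxy].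
    have cl : closed H [pred z | l x == l z].
      by move=> a b /andP[_ /eqP ab]; rewrite !inE ab.
    by have := closed_connect cl cxy; rewrite !inE eqxx => <-.
  case: (eqVneq x y) => [->|nxy]; first exact: connect0.
  by apply: connect1; rewrite /= /e nxy.
exists 'I_#|component H x|, (complete #|component H x|); split.
  by have := card_l x; rewrite -compE !inE => /orP[] /eqP ->; constructor.
apply: isomorphic_complete => a b; rewrite compE !inE => /eqP la /eqP lb nab.
by rewrite /= /e nab -la lb eqxx.
Qed.

End Factors.

(** * Partial plays against a fixed strategy of Dominator *)

Section Plays.
Variables (T : finType) (G : sgraph T) (first : bool) (sigma : seq T -> T).
Implicit Types (h p : seq T) (x y : T).

Definition partial_play h := uniq h /\ follows first sigma h.

Lemma partial_play_rcons h x : partial_play h -> x \notin h ->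
    (dominator_turn first (size h) -> x = sigma h) ->
  partial_play (rcons h x).
Proof.
move=> [uh fh] xh sx; split=> [|h' y r]; first by rewrite rcons_uniq xh.
case: (lastP r) => [|r' z].
  by rewrite cats1 => /rcons_inj[<- <-].
by rewrite -rcons_cons -rcons_cat => /rcons_inj[eh _]; apply: fh eh.
Qed.

(** Winning is judged on full plays, so a history has to be filled up: Dominator follows [sigma],
    Staller takes any free vertex. The induction is on the number of free vertices. *)
Lemma partial_play_complete h : legal_strategy first sigma -> partial_play h ->
  exists2 r, full_play (h ++ r) & follows first sigma (h ++ r).
Proof.
move=> lsigma; have [m] := ubnP (#|T| - size h).
elim: m h => // m IHm h le_m pph; have [uh fh] := pph.
have := max_card (mem h); rewrite (card_uniqP uh) leq_eqVlt.
case/predU1P=> [full|sh]; first by exists [::]; rewrite cats0.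
have [x xh sx] : exists2 x, x \notin h & dominator_turn first (size h) -> x = sigma h.
  case: (boolP (dominator_turn first (size h))) => [dt|_].
    by exists (sigma h) => //; apply: lsigma.
  by have [x xh] := exists_unclaimed uh sh; exists x.
have [|r fr fs] := IHm _ _ (partial_play_rcons pph xh sx).
  by rewrite size_rcons; lia.
by exists (x :: r); rewrite -cat_rcons.
Qed.

Definition staller_claimed h : {set T} :=
  [set x in h | ~~ dominator_turn first (index x h)].

Lemma staller_claimed_cat h r x :
  x \in staller_claimed h -> x \in staller_claimed (h ++ r).
Proof. by rewrite !inE mem_cat index_cat => /andP[-> ->]. Qed.

Lemma staller_claimed_rcons h y x :
  x \in staller_claimed h -> x \in staller_claimed (rcons h y).
Proof. by rewrite -cats1; apply: staller_claimed_cat. Qed.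

Lemma staller_claimed_last h x : x \notin h -> ~~ dominator_turn first (size h) ->
  x \in staller_claimed (rcons h x).
Proof. by move=> xh nd; rewrite inE mem_rcons mem_head -cats1 index_cat (negPf xh) /= eqxx addn0. Qed.

Definition staller_isolates h := exists x, closed_nbhd G x \subset staller_claimed h.

(** Claims are permanent: in every completion Staller keeps the closed neighborhood of [x], so
    Dominator never dominates [x]. *)
Lemma staller_isolates_wins h :
    legal_strategy first sigma -> partial_play h -> staller_isolates h ->
  exists p, [/\ full_play p, follows first sigma p & ~ dominator_wins G first p].
Proof.
move=> lsigma pph [x /subsetP Nx].
have [r full fs] := partial_play_complete lsigma pph.
exists (h ++ r); split=> // -[k /(_ x)[y]]; rewrite inE => /andP[yk dy] xy.
have yx : y \in closed_nbhd G x by move: xy; rewrite !inE eq_sym edge_sym.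
have := staller_claimed_cat r (Nx _ yx); rewrite inE => /andP[_].
(* A vertex has the same index in a prefix as in the whole play, so it cannot count for both
   players. *)
by rewrite -{1}(cat_take_drop k (h ++ r)) index_cat yk dy.
Qed.

End Plays.

(** * Vertex orderings with the umbrella property: cut-vertices and block factors *)

Section Ordered.
Variables (T : finType) (G : sgraph T) (n : nat) (v : 'I_n -> T).
Hypothesis v_bij : bijective v.
Hypothesis edge_succ : forall i j : 'I_n, j = i.+1 :> nat -> G (v i) (v j).
Hypothesis edge_umbrella : forall i j i' j' : 'I_n,
  i <= i' -> i' < j' -> j' <= j -> G (v i) (v j) -> G (v i') (v j').

Lemma v_surj x : exists i, x = v i.
Proof. by have [w _ wK] := v_bij; exists (w x); rewrite wK. Qed.

(** With the chord, every vertex other than [v k] reaches vertex 0 by decreasing indices, jumping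
    over [k] along the chord. Without it, no edge leads from below [k] to above [k], since the
    umbrella property would turn it into the chord. *)
Lemma cut_vertexP (i k j : 'I_n) : i.+1 = k -> j = k.+1 :> nat ->
  G (v i) (v j) <-> ~ cut_vertex G (v k).
Proof.
move=> ik jk; have v_inj := bij_inj v_bij.
have notk m : m != k -> v m \in ~: [set v k].
  by move=> nmk; rewrite !inE (inj_eq v_inj).
pose V m (nmk : m != k) : {x | x \in ~: [set v k]} :=
  exist (fun x => x \in ~: [set v k]) (v m) (notk m nmk).
have nik : i != k by rewrite -val_eqE /=; lia.
have njk : j != k by rewrite -val_eqE /=; lia.
split=> [Gij|ncut].
  have n0 : 0 < n by apply: leq_ltn_trans (ltn_ord i).
  have n0k : Ordinal n0 != k by rewrite -val_eqE /=; lia.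
  apply; set K := induced _ _; pose z := V _ n0k.
  suff toz u : connect K z u.
    by move=> x y; apply: connect_trans (toz y); rewrite sgraph_connect_sym.
  have [m um] := v_surj (val u); have [N] := ubnP m.
  elim: N m u um => // N IHN m u um lemN.
  have nmk : m != k by apply/eqP=> mk; have := valP u; rewrite um mk !inE eqxx.
  have [m0|m0] := posnP m.
    suff -> : u = z by apply: connect0.
    by apply: val_inj; rewrite um; congr v; apply: val_inj.
  (* The predecessor of [m] serves, except at [j], where it would be the removed vertex. *)
  have [m' [lt_m' nm' Gm']] : exists m' : 'I_n, [/\ m' < m, m' != k & G (v m') (v m)].
    case: (eqVneq (m : nat) j) => [mj|nmj].
      exists i; split; first by rewrite mj; lia.
        by rewrite -val_eqE /=; lia.
      by rewrite (_ : m = j) //; apply: val_inj.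
    have ltm : m.-1 < n by have := ltn_ord m; lia.
    exists (Ordinal ltm); split; rewrite -?val_eqE /=; try lia.
    by apply: edge_succ => /=; lia.
  pose w := V _ nm'.
  apply: (@connect_trans _ _ w); first by apply: (IHN m' w erefl); lia.
  by apply: connect1; rewrite /= /induced_edge um.
apply/negPn/negP=> nGij; apply: ncut => conn.
have [w vK wK] := v_bij.
have cl : closed (induced G (~: [set v k])) [pred u | w (val u) < k].
  apply: intro_closed; first exact: sgraph_connect_sym.
  move=> x y; rewrite /= /induced_edge !inE => Gxy ltx; rewrite ltnNge; apply/negP=> lty.
  have nyk : w (sval y) != k.
    by apply/eqP=> e; have := valP y; rewrite /= -[sval y]wK e !inE eqxx.
  case/negP: nGij; apply: (@edge_umbrella (w (sval x)) (w (sval y))); try lia.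
    by move: nyk; rewrite -val_eqE /=; lia.
  by rewrite !wK.
have := closed_connect cl (conn (V _ nik) (V _ njk)).
by rewrite !inE /= !vK; lia.
Qed.

Lemma card_index_interval (w : T -> 'I_n) a b : bijective w -> b < n ->
  #|[set y | a <= w y <= b]| = b.+1 - a.
Proof.
move=> w_bij ltbn; transitivity #|[set i : 'I_n | a <= i <= b]|.
  rewrite -(on_card_preimset (onW_bij _ w_bij)).
  by apply: eq_card => y; rewrite !inE.
rewrite -sum1_card -[RHS]muln1 -sum_nat_const_nat.
rewrite (big_nat_widen _ _ n) // big_geq_mkord.
by apply: eq_bigl => i; rewrite inE ltnS andbC.
Qed.

(* The blocks are [{0, 1}, {2, 3}, ...], with a triple [{k-1, k, k+1}] in the
   second case; when [n <= k] the triple lies outside the range. *)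
Lemma factor_of_blocks k : odd k ->
    ~~ odd n /\ n <= k \/ odd n /\ k.+1 < n ->
    (forall i j : 'I_n, i.+1 = k -> j = k.+1 :> nat -> G (v i) (v j)) ->
  exists H, is_factor K2_K3 G H.
Proof.
move=> oddk casek chord; have [w vK wK] := v_bij.
(* The shift beyond the odd number [k] gives [k-1], [k] and [k+1] the common label [k./2]; every
   other label belongs to a consecutive pair. *)
pose l i := if i <= k then i./2 else i.-1./2.
have lE i : i <= k /\ l i = i./2 \/ k < i /\ l i = i.-1./2.
  by rewrite /l; case: leqP; [left|right].
apply: (@factor_of_labelling _ _ (fun x => l (w x))) => [x y lxy nxy|x].
  wlog ltxy : x y lxy nxy / w x < w y.
    move=> wl; case: (ltngtP (w x) (w y)) => [|lt|exy]; first exact: wl.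
      by rewrite edge_sym; apply: wl => //; rewrite eq_sym.
    by case/eqP: nxy; rewrite -(wK x) -(wK y); congr v; apply: val_inj.
  rewrite -(wK x) -(wK y).
  (* Two vertices with one label are consecutive or the two ends of the triple. *)
  have [e|[ex ey]] : (w x).+1 = w y \/ (w x).+1 = k /\ w y = k.+1 :> nat.
  - by have := lE (w x); have := lE (w y); move: lxy; lia.
  - exact: edge_succ.
  - exact: chord.
have wbij : bijective w by exists v.
have block a b : a <= b < n -> (b - a) \in [:: 1; 2] ->
    (forall i, i < n -> (l (w x) == l i) = (a <= i <= b)) ->
    #|[set y | l (w x) == l (w y)]| \in [:: 2; 3].
  move=> /andP[leab ltbn] ab abP.
  rewrite (_ : [set y | _] = [set y | a <= w y <= b]).
    by rewrite card_index_interval //; move: ab; rewrite !inE; lia.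
  by apply/setP=> y; rewrite !inE abP.
have := ltn_ord (w x); move: (w x : nat) block => i block ltin.
(* The cases are a pair before the triple, a pair after it, and the triple itself. *)
case: (ltngtP (l i) k./2) => [lt|gt|eq].
- apply: (block (l i).*2 (l i).*2.+1) => [||j ltj]; rewrite ?inE; have := lE i;
  try (have := lE j); lia.
- apply: (block (l i).*2.+1 (l i).*2.+2) => [||j ltj]; rewrite ?inE; have := lE i;
  try (have := lE j); lia.
- apply: (block k.-1 k.+1) => [||j ltj]; rewrite ?inE; have := lE i;
  try (have := lE j); lia.
Qed.

(** * Staller's forcing moves when no vertex of odd 0-based index is bridged by a chord *)

Hypothesis no_chord : forall i j : 'I_n, odd i.+1 -> j = i.+2 :> nat -> ~~ G (v i) (v j).

(** By the umbrella property, a neighbor two or more places away would yield a chord over the odd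
    index next to [i] on that side. *)
Lemma closed_nbhd_even (i j : 'I_n) :
  ~~ odd i -> v j \in closed_nbhd G (v i) -> i.-1 <= j <= i.+1.
Proof.
rewrite inE => eveni /predU1P[/(bij_inj v_bij) ->|Gij]; first by lia.
apply/negPn/negP=> far.
have [ltij|leji] := ltnP i j.
  have lt2 : i.+2 < n by have := ltn_ord j; lia.
  have /negP[] := @no_chord i (Ordinal lt2) eveni erefl.
  by apply: edge_umbrella Gij => /=; lia.
have lt2 : i.-2 < n by have := ltn_ord i; lia.
have /negP[] := @no_chord (Ordinal lt2) i ltac:(move=> /=; lia) ltac:(move=> /=; lia).
by rewrite edge_sym in Gij; apply: edge_umbrella Gij => /=; lia.
Qed.

(** Staller started and an even number of moves is made, so Staller is to move; claiming [v i]
    completes its closed neighborhood, whose other vertices have odd index. *)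
Lemma staller_isolates_even sigma h : legal_strategy false sigma ->
    partial_play false sigma h ->
  forall i : 'I_n, ~~ odd i -> v i \notin h -> ~~ odd (size h) ->
    (forall j : 'I_n, odd j -> i.-1 <= j <= i.+1 -> v j \in staller_claimed false h) ->
  exists2 h', partial_play false sigma h' & staller_isolates G false h'.
Proof.
move=> legal pph i eveni vih evenh odds.
have nturn : ~~ dominator_turn false (size h) by rewrite /dominator_turn addbF.
exists (rcons h (v i)).
  by apply: partial_play_rcons => // dt; rewrite dt in nturn.
exists (v i); apply/subsetP=> y; have [j ->] := v_surj y.
move=> /(closed_nbhd_even eveni) ij; case: (boolP (odd j)) => [oddj|evenj].
  by apply: staller_claimed_rcons; apply: odds.
rewrite (_ : j = i); first exact: staller_claimed_last.
by apply: val_inj => /=; lia.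
Qed.

(** After [m] rounds Staller claims index [m.*2.+1], threatening to isolate index [m.*2], whose
    other possible neighbor already belongs to Staller. Either Dominator answers there, and the
    claimed vertices again form an initial segment, or Staller carries out the threat. *)
Lemma staller_forces sigma m : legal_strategy false sigma -> m.*2 < n ->
  (exists2 h, partial_play false sigma h & staller_isolates G false h) \/
  exists h, [/\ partial_play false sigma h, size h = m.*2,
    forall i, (v i \in h) = (i < m.*2) &
    forall i : 'I_n, odd i -> i < m.*2 -> v i \in staller_claimed false h].
Proof.
move=> legal; elim: m => [|m IHm] ltmn.
  right; exists [::]; split=> //; split=> // h x r; by case: h.
case: IHm => [|win|[h [pph sh hE odds]]]; [by lia|by left|].
have lt0 : m.*2 < n by lia.
have lt1 : m.*2.+1 < n by lia.
pose a := v (Ordinal lt0); pose b := v (Ordinal lt1).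
have dturn i : dominator_turn false i = odd i by rewrite /dominator_turn addbF.
have bh : b \notin h by rewrite hE /=; lia.
pose h1 := rcons h b.
have pph1 : partial_play false sigma h1.
  by apply: partial_play_rcons => //; rewrite dturn sh odd_double.
have b1 : b \in staller_claimed false h1.
  by apply: staller_claimed_last => //; rewrite dturn sh odd_double.
have sh1 : size h1 = m.*2.+1 by rewrite size_rcons sh.
have yh1 : sigma h1 \notin h1.
  apply: legal; first by case: pph1.
    by rewrite -(bij_eq_card v_bij) card_ord sh1.
  by rewrite dturn sh1 /= odd_double.
pose h2 := rcons h1 (sigma h1).
have pph2 : partial_play false sigma h2 by apply: partial_play_rcons.
have odds2 (i : 'I_n) : odd i -> i < m.*2.+2 -> v i \in staller_claimed false h2.
  move=> oddi lti; apply: staller_claimed_rcons.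
  have [e|ne] := eqVneq (i : nat) m.*2.+1.
    by rewrite (_ : v i = b) //; congr v; apply: val_inj.
  by apply: staller_claimed_rcons; apply: odds => //; lia.
have [ya|nya] := eqVneq (sigma h1) a; last first.
  left; apply: (staller_isolates_even legal pph2 (i := Ordinal lt0)) => /=.
  - by rewrite odd_double.
  - rewrite mem_rcons inE eq_sym (negPf nya) mem_rcons inE hE (inj_eq (bij_inj v_bij)).
    by rewrite -val_eqE /=; lia.
  - by rewrite size_rcons sh1 /= odd_double.
  - by move=> j oddj ltj; apply: odds2 => //; lia.
right; exists h2; split=> // [|i].
  by rewrite size_rcons sh1 doubleS.
rewrite mem_rcons inE ya mem_rcons inE hE !(inj_eq (bij_inj v_bij)) -!val_eqE /=.
by lia.
Qed.

Lemma staller_wins : odd n -> ~ outcome_D G.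
Proof.
move=> oddn /(_ false)[sigma legal wins].
have [h pph iso] : exists2 h, partial_play false sigma h & staller_isolates G false h.
  (* As [n] is odd, [n./2.*2] is the last index; if every threat was answered, only this vertex is
     free and Staller claims it. *)
  have lt2 : n./2.*2 < n by lia.
  have [//|[h [pph sh hE odds]]] := staller_forces legal lt2.
  apply: (staller_isolates_even legal pph (i := Ordinal lt2)) => /=.
  - by rewrite odd_double.
  - by rewrite hE /= ltnn.
  - by rewrite sh odd_double.
  - by move=> j oddj _; apply: odds => //; have := ltn_ord j; lia.
have [p [full fs]] := staller_isolates_wins legal pph iso.
by apply; apply: wins.
Qed.

End Ordered.

(** * The ordering of a unit interval graph by left endpoints *)

Section UnitInterval.
Variables (R : realType) (T : finType) (G : sgraph T) (start : T -> R).
Hypothesis rep : unit_interval_rep G start.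
Local Open Scope ring_scope.

(** If the two intervals meet, the later left endpoint is a common point. *)
Lemma unit_interval_adjacent x y :
  x != y -> start x <= start y -> G x y = (start y <= start x + 1).
Proof.
move=> nxy lexy; apply/idP/idP => [/(rep nxy)[t []]|le1].
  by rewrite !in_itv /= => /andP[_ tx] /andP[yt _]; apply: le_trans tx.
by apply/(rep nxy); exists (start y); rewrite !in_itv /= lexy lexx le1 lerDl ler01.
Qed.

Variables (n : nat) (v : 'I_n -> T).
Hypothesis v_bij : bijective v.
Hypothesis v_sorted : forall i j : 'I_n, (i <= j)%N -> start (v i) <= start (v j).

Lemma unit_interval_ordered_adjacent (i j : 'I_n) :
  (i < j)%N -> G (v i) (v j) = (start (v j) <= start (v i) + 1).
Proof.
move=> ltij; apply: unit_interval_adjacent; last exact/v_sorted/ltnW.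
by rewrite (inj_eq (bij_inj v_bij)) -val_eqE neq_ltn ltij.
Qed.

(** Moving the two indices towards each other cannot increase the distance of the left endpoints. *)
Lemma unit_interval_umbrella (i j i' j' : 'I_n) :
    (i <= i')%N -> (i' < j')%N -> (j' <= j)%N ->
  G (v i) (v j) -> G (v i') (v j').
Proof.
move=> le_i lt_ij le_j.
rewrite !unit_interval_ordered_adjacent //; last by lia.
by have := v_sorted le_i; have := v_sorted le_j; lra.
Qed.

(** Without this edge the umbrella property forbids every edge leaving the initial segment up to
    [i], against connectedness. *)
Lemma unit_interval_succ (i j : 'I_n) :
  connected G -> j = i.+1 :> nat -> G (v i) (v j).
Proof.
move=> conn ji; apply/negPn/negP=> nGij; have [w vK wK] := v_bij.
have cl : closed G [pred x | (w x <= i)%N].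
  apply: intro_closed; first exact: sgraph_connect_sym.
  move=> x y; rewrite -{1}(wK x) -{1}(wK y) !inE => Gxy lex.
  rewrite leqNgt; apply/negP=> lty; case/negP: nGij.
  by apply: unit_interval_umbrella Gxy; lia.
by have := closed_connect cl (conn (v i) (v j)); rewrite !inE !vK; lia.
Qed.

End UnitInterval.

(** * Closing the cycle of implications *)

Theorem theorem4p5 (R : realType) (T : finType) (G : sgraph T)
    (start : T -> R) (n : nat) (v : 'I_n -> T)
    (G_connected : connected G)
    (G_unit_interval : unit_interval_rep G start)
    (n_ge2 : 2 <= n)
    (v_bij : bijective v)
    (v_sorted : forall i j : 'I_n, i <= j -> (start (v i) <= start (v j))%R) :
  [<-> outcome_D G;
       exists H : sgraph T, is_factor K2_K3 G H;
       exists P : seq (T * T), pairing_dominating G P;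
       ~~ odd n \/
       (* 'I_n is 0-based: v_j of the paper is [v k] with j = k + 1 *)
       exists (i : nat) (k : 'I_n), 2 * i = k.+1 /\ ~ cut_vertex G (v k)].
Proof.
have succ i j := unit_interval_succ G_unit_interval v_bij v_sorted G_connected (i := i) (j := j).
have umbrella := unit_interval_umbrella G_unit_interval v_bij v_sorted.
have cutP := cut_vertexP v_bij succ umbrella.
set P4 := (_ \/ _).
have P3_P1 : (exists P, pairing_dominating G P) -> outcome_D G.
  by case=> P; apply: outcome_D_pairing; apply: v (Ordinal (ltnW n_ge2)).
have P2_P3 : (exists H, is_factor K2_K3 G H) -> exists P, pairing_dominating G P.
  by case=> H; apply: pairing_of_factor.
have P4_P2 : P4 -> exists H, is_factor K2_K3 G H.
  have [oddn|evenn] := boolP (odd n); last first.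
    (* The odd value [n.+1] is out of range, so there is no triple and the chord condition is
       vacuous. *)
    move=> _; apply: (factor_of_blocks v_bij succ (k := n.+1)) => //; first by left; lia.
    by move=> i j; have := ltn_ord i; lia.
  case=> [|[m [k [mk ncut]]]]; first by rewrite oddn.
  apply: (factor_of_blocks v_bij succ (k := k)).
  - by lia.
  (* Both [n] and [k] are odd, so [k] is not the last index and the triple fits. *)
  - by right; have := ltn_ord k; lia.
  - by move=> i j ik jk; have [_] := cutP i k j ik jk; apply.
have P1_P4 : outcome_D G -> P4.
  move=> outD; have [oddn|] := boolP (odd n); last by left.
  (* The case split is on chords, which are decidable: a chord shows that the vertex under it is no
     cut-vertex, and without chords Staller wins. *)
  have [chord|no_chord] := boolP [exists i : 'I_n, exists j : 'I_n,
      [&& odd i.+1, j == i.+2 :> nat & G (v i) (v j)]].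
    have [i /existsP[j /and3P[oddi /eqP ij Gij]]] := existsP chord.
    right; have ltk : i.+1 < n by have := ltn_ord j; lia.
    exists (i.+2)./2, (Ordinal ltk); split=> /=; first by lia.
    by have [+ _] := cutP i (Ordinal ltk) j erefl ij; apply.
  case: (staller_wins v_bij umbrella _ oddn outD) => i j oddi ij.
  apply: contraNN no_chord => Gij; apply/existsP; exists i; apply/existsP; exists j.
  by rewrite oddi ij eqxx.
tfae; tauto.
Qed.
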